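(* Let $\varphi\colon \mathbb{Z}_{12} \to \mathbb{Z}_{12}$ be an element of the $T/I$-group and let $(\mathbb{Z}_{12},\mu^\varphi)$ denote the $\mathcal{T}$-action given by the $\varphi$-conjugation of the natural action of the triadic monoid $\mathcal{T}$, that is, $m\in\mathcal{T}$ acts on $\mathbb{Z}_{12}$ by $\varphi m\varphi^{-1}$. Let $C=\{0,4,7\}$. Then the maximal covers of the $j_{\mathcal{P}}$-, $j_{\mathcal{L}}$-, and $j_{\mathcal{R}}$-upgrades of the subaction $(\varphi(C),\mu^{\varphi}|_{\varphi(C)})$ of $(\mathbb{Z}_{12},\mu^\varphi)$ admit simply transitive actions by subgroups of the $PLR$-group. In fact, these upgrades and their maximal covers are the $\varphi$-images of the corresponding upgrades of $C$ (as a subaction of the natural $\mathcal{T}$-action on $\mathbb{Z}_{12}$) and their respective maximal covers, and the $PLR$-subgroups remain the same. Explicitly: \begin{itemize} \item the $j_{\mathcal{P}}$-upgrade has carrier set $\varphi(\{0,3,4,7\})$, and $\langle P\rangle$ acts simply transitively on its maximal cover; \item the $j_{\mathcal{L}}$-upgrade has carrier set $\varphi(\{0,3,4,7,8,11\})$, and $\langle P,L\rangle$ acts simply transitively on its maximal cover; \item the $j_{\mathcal{R}}$-upgrade has carrier set $\varphi(\{0,1,3,4,6,7,9,10\})$, and $\langle P,R\rangle$ acts simply transitively on its maximal cover. \end{itemize}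
   Context: The $T/I$-group is the group of the 24 bijections of $\mathbb{Z}_{12}$ of the form $T_n(z)=z+n$ and $I_n(z)=-z+n$, $n\in\mathbb{Z}_{12}$. The triadic monoid $\mathcal{T}$ is the monoid (under composition) of all maps $z\mapsto mz+b$ ($m,b\in\mathbb{Z}_{12}$) from $\mathbb{Z}_{12}$ to itself which map $\{0,4,7\}$ into $\{0,4,7\}$. It has 8 elements: the identity, $f(z)=3z+7$, $f^2(z)=9z+4$, $g(z)=8z+4$, $g^2(z)=4z$, and the three constant maps $0,4,7$, denoted $a,b,c$ (in some order); it is generated by $f$ and $g$. The natural action is $\mathcal{T}\times\mathbb{Z}_{12}\to\mathbb{Z}_{12}$, $(m,z)\mapsto m(z)$. A subaction of a $\mathcal{T}$-action is its restriction to a subset (the carrier set) closed under the action. The set $\Omega$ of left ideals of $\mathcal{T}$ (subsets $\mathcal{B}$ with $nm\in\mathcal{B}$ for all $n\in\mathcal{T}$, $m\in\mathcal{B}$) is $\Omega=\{\emptyset,\mathcal{C},\mathcal{L},\mathcal{R},\mathcal{P},\mathcal{T}\}$ with $\mathcal{C}=\{a,b,c\}$, $\mathcal{L}=\{a,b,c,f,f^2\}$, $\mathcal{R}=\{a,b,c,g,g^2\}$, $\mathcal{P}=\{a,b,c,f,f^2,g,g^2\}$; $\mathcal{T}$ acts on $\Omega$ by $m\cdot\mathcal{B}=\{n\in\mathcal{T} : nm\in\mathcal{B}\}$. $\Omega$ is the subobject classifier of the topos $\mathbf{Set}^{\mathcal{T}}$ of $\mathcal{T}$-sets and equivariant maps.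 A Lawvere--Tierney topology is a $\mathcal{T}$-equivariant map $j\colon\Omega\to\Omega$ with $j(\mathcal{T})=\mathcal{T}$, $j\circ j=j$, and $j(\mathfrak{r})\cap j(\mathfrak{s})=j(\mathfrak{r}\cap\mathfrak{s})$ for all $\mathfrak{r},\mathfrak{s}\in\Omega$. The three topologies used here are given as follows: \begin{itemize} \item $j_{\mathcal{P}}$: $\mathcal{T},\mathcal{P}\mapsto\mathcal{T}$; $\mathcal{L}\mapsto\mathcal{L}$; $\mathcal{R}\mapsto\mathcal{R}$; $\mathcal{C}\mapsto\mathcal{C}$; $\emptyset\mapsto\emptyset$. \item $j_{\mathcal{L}}$: $\mathcal{T},\mathcal{P},\mathcal{L}\mapsto\mathcal{T}$; $\mathcal{R},\mathcal{C}\mapsto\mathcal{R}$; $\emptyset\mapsto\emptyset$. \item $j_{\mathcal{R}}$: $\mathcal{T},\mathcal{P},\mathcal{R}\mapsto\mathcal{T}$; $\mathcal{L},\mathcal{C}\mapsto\mathcal{L}$; $\emptyset\mapsto\emptyset$. \end{itemize} If $D$ is a sub-$\mathcal{T}$-set of a $\mathcal{T}$-set $E$, its characteristic morphism is $\chi\colon E\to\Omega$, $\chi(x)=\{m\in\mathcal{T} : m\text{ sends }x\text{ into }D\}$ (with respect to the action on $E$). For a Lawvere--Tierney topology $j$, the $j$-upgrade of $D$ is the sub-$\mathcal{T}$-set of $E$ with carrier set $(j\circ\chi)^{-1}(\mathcal{T})$. The consonant triads are the major triads $\{n,n+4,n+7\}$ and minor triads $\{n,n+3,n+7\}$, $n\in\mathbb{Z}_{12}$.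 The maximal cover of a subset $\mathcal{S}\subseteq\mathbb{Z}_{12}$ is the collection of all consonant triads $Y\subseteq\mathcal{S}$. The image under $\varphi$ of a collection of triads is the collection of the images $\varphi(Y)$. The $PLR$-group is the group of permutations of the set of 24 consonant triads generated by the involutions, for $n \in \mathbb{Z}_{12}$: $P$ exchanging $\{n,n+4,n+7\}$ and $\{n,n+3,n+7\}$; $L$ exchanging $\{n,n+4,n+7\}$ and $\{n+4,n+7,n+11\}$; $R$ exchanging $\{n,n+4,n+7\}$ and $\{n+9,n,n+4\}$. A subgroup of the $PLR$-group acts simply transitively on a collection $\mathbb{S}$ of triads if its natural action maps $\mathbb{S}$ to itself and for any $X,Y\in\mathbb{S}$ exactly one element of the subgroup sends $X$ to $Y$. Angle brackets denote the subgroup generated. *)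

(* Defs.v *)
From HB Require Import structures.
From mathcomp Require Import all_boot all_order all_algebra all_fingroup.

Set Implicit Arguments.
Unset Strict Implicit.
Unset Printing Implicit Defensive.

Import GRing.Theory GroupScope.
Local Open Scope ring_scope.

Notation Z12 := 'Z_12.

Definition transp (n : Z12) : {perm Z12} := perm (addIr n).

Lemma inversion_inj (n : Z12) : injective (fun z : Z12 => - z + n).
Proof. by move=> x y /addIr /oppr_inj. Qed.

Definition inversion (n : Z12) : {perm Z12} := perm (@inversion_inj n).

Definition TI_set : {set {perm Z12}} :=
  [set transp n | n in Z12] :|: [set inversion n | n in Z12].

Lemma TI_group_set : group_set TI_set.
Proof.
apply/group_setP; split.
  rewrite inE; apply/orP; left; apply/imsetP; exists 0 => //.
  by apply/permP => z; rewrite perm1 permE addr0.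
move=> p q; rewrite !inE => /orP[] /imsetP[n _ ->] /orP[] /imsetP[k _ ->];
  apply/orP.
- left; apply/imsetP; exists (n + k) => //.
  by apply/permP => z; rewrite permM !permE addrA.
- right; apply/imsetP; exists (k - n) => //.
  by apply/permP => z; rewrite permM !permE opprD -addrA (addrC (- n)).
- right; apply/imsetP; exists (n + k) => //.
  by apply/permP => z; rewrite permM !permE addrA.
- left; apply/imsetP; exists (k - n) => //.
  by apply/permP => z; rewrite permM !permE opprD opprK -addrA (addrC (- n)).
Qed.

Definition TI : {group {perm Z12}} := Group TI_group_set.

Definition Ctriad : {set Z12} := [set 0; 4; 7].

Definition affine (m b : Z12) : {ffun Z12 -> Z12} := [ffun z => m * z + b].

Definition is_triadic (h : {ffun Z12 -> Z12}) : bool :=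
  [exists m, exists b, h == affine m b] && (h @: Ctriad \subset Ctriad).

Record triadic : Type := Triadic { tfun :> {ffun Z12 -> Z12}; _ : is_triadic tfun }.

HB.instance Definition _ := [isSub for tfun].
HB.instance Definition _ := [Finite of triadic by <:].

Lemma triadicP (t : triadic) : is_triadic t. Proof. by case: t. Qed.

Lemma triadic_eq (s t : triadic) : s =1 t -> s = t.
Proof. by move=> st; apply/val_inj/ffunP. Qed.

Lemma affine_triadic (m b : Z12) :
  [&& b \in [:: 0; 4; 7], m * 4 + b \in [:: 0; 4; 7] & m * 7 + b \in [:: 0; 4; 7]] ->
  is_triadic (affine m b).
Proof.
rewrite !inE => /and3P[h0 h4 h7]; apply/andP; split.
  by apply/existsP; exists m; apply/existsP; exists b.
apply/subsetP => y /imsetP[x]; rewrite !inE => xC ->.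
by case/orP: xC => [/orP[]|] /eqP ->; rewrite ffunE ?mulr0 ?add0r -!orbA.
Qed.

Lemma tone_subproof : is_triadic [ffun z => z].
Proof.
have -> : [ffun z => z] = affine 1 0 by apply/ffunP => z; rewrite !ffunE mul1r addr0.
exact: affine_triadic.
Qed.
Definition tone : triadic := Triadic tone_subproof.

Lemma tmul_subproof (s t : triadic) : is_triadic [ffun z => s (t z)].
Proof.
have /andP[/existsP[m /existsP[b /eqP sE]] sC] := triadicP s.
have /andP[/existsP[n /existsP[c /eqP tE]] tC] := triadicP t.
apply/andP; split.
  apply/existsP; exists (m * n); apply/existsP; exists (m * c + b).
  by apply/eqP/ffunP => z; rewrite sE tE !ffunE mulrDr mulrA addrA.
apply/subsetP => y /imsetP[x xC ->]; rewrite ffunE.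
by apply: (subsetP sC); apply: imset_f; apply: (subsetP tC); apply: imset_f.
Qed.
(** The product [s * t] is "first [t], then [s]". *)
Definition tmul (s t : triadic) : triadic := Triadic (tmul_subproof s t).

Fact tmulA : associative tmul.
Proof. by move=> s t u; apply: triadic_eq => z; rewrite !ffunE. Qed.
Fact tmul1 : left_id tone tmul.
Proof. by move=> s; apply: triadic_eq => z; rewrite !ffunE. Qed.
Fact t1mul : right_id tone tmul.
Proof. by move=> s; apply: triadic_eq => z; rewrite !ffunE. Qed.

HB.instance Definition _ := isMonoid.Build triadic tmulA tmul1 t1mul.

Definition tf : triadic := Triadic (@affine_triadic 3 7 isT).
Definition tg : triadic := Triadic (@affine_triadic 8 4 isT).
Definition tconst0 : triadic := Triadic (@affine_triadic 0 0 isT).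
Definition tconst4 : triadic := Triadic (@affine_triadic 0 4 isT).
Definition tconst7 : triadic := Triadic (@affine_triadic 0 7 isT).

(** Carriers are finite: only [Z12] and [Omega] are needed. *)
Record Tset : Type := TSet {
  carrier :> finType;
  tact : triadic -> carrier -> carrier;
  tact1 : forall x, tact 1%g x = x;
  tactM : forall s t x, tact (s * t)%g x = tact s (tact t x)
}.

Record subTset (E : Tset) : Type := SubTset {
  subset_of :> {set E};
  subset_ofP : forall (m : triadic) (x : E), x \in subset_of -> tact m x \in subset_of
}.

Definition equivariant (E F : Tset) (h : E -> F) : Prop :=
  forall (m : triadic) (x : E), h (tact m x) = tact m (h x).

Lemma natural_act1 (z : Z12) : (1%g : triadic) z = z.
Proof. by rewrite ffunE. Qed.
Lemma natural_actM (s t : triadic) (z : Z12) : (s * t)%g z = s (t z).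
Proof. by rewrite ffunE. Qed.

Definition natural_Tset : Tset :=
  @TSet Z12 (fun m z => m z) natural_act1 natural_actM.

(** The action of [m] is the map [phi \o m \o phi^-1]. *)
Definition mu (phi : {perm Z12}) (m : triadic) (z : Z12) : Z12 :=
  phi (m ((phi^-1)%g z)).

Lemma mu1 phi z : mu phi 1%g z = z.
Proof. by rewrite /mu natural_act1 permKV. Qed.
Lemma muM phi s t z : mu phi (s * t)%g z = mu phi s (mu phi t z).
Proof. by rewrite /mu natural_actM permK. Qed.

Definition conj_Tset (phi : {perm Z12}) : Tset :=
  @TSet Z12 (mu phi) (@mu1 phi) (@muM phi).

Lemma natural_C_stable (m : triadic) (x : natural_Tset) :
  x \in Ctriad -> tact m x \in Ctriad.
Proof.
by move=> xC; have /andP[_ /subsetP] := triadicP m; apply; apply: imset_f.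
Qed.
Definition natural_C : subTset natural_Tset :=
  @SubTset natural_Tset Ctriad natural_C_stable.

Lemma conj_C_stable (phi : {perm Z12}) (m : triadic) (x : conj_Tset phi) :
  x \in phi @: Ctriad -> tact m x \in phi @: Ctriad.
Proof.
case/imsetP => y yC ->; rewrite /= /mu permK.
by apply: imset_f; apply: natural_C_stable.
Qed.
Definition conj_C (phi : {perm Z12}) : subTset (conj_Tset phi) :=
  @SubTset (conj_Tset phi) (phi @: Ctriad) (@conj_C_stable phi).

Definition left_ideal (B : {set triadic}) : bool :=
  [forall n : triadic, forall m : triadic in B, (n * m)%g \in B].

Record Omega : Type := Ideal { ideal :> {set triadic}; _ : left_ideal ideal }.

HB.instance Definition _ := [isSub for ideal].
HB.instance Definition _ := [Finite of Omega by <:].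

Lemma left_idealP (B : {set triadic}) :
  reflect (forall n m : triadic, m \in B -> (n * m)%g \in B) (left_ideal B).
Proof.
apply: (iffP forallP) => [h n m mB | h n].
  by move/forall_inP: (h n); apply.
by apply/forall_inP => m; apply: h.
Qed.

Lemma ideal_closed (B : Omega) (n m : triadic) : m \in (B : {set _}) -> (n * m)%g \in (B : {set _}).
Proof. by case: B => B /= /left_idealP; apply. Qed.

Lemma omega_act_subproof (m : triadic) (B : Omega) :
  left_ideal [set n : triadic | (n * m)%g \in (B : {set _})].
Proof. by apply/left_idealP => k n; rewrite !inE -mulgA; apply: ideal_closed. Qed.
Definition omega_act (m : triadic) (B : Omega) : Omega :=
  Ideal (omega_act_subproof m B).

Lemma omega_act1 B : omega_act 1%g B = B.
Proof. by apply/val_inj/setP => n; rewrite inE mulg1. Qed.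
Lemma omega_actM s t B : omega_act (s * t)%g B = omega_act s (omega_act t B).
Proof. by apply/val_inj/setP => n; rewrite !inE mulgA. Qed.

Definition Omega_Tset : Tset := @TSet Omega omega_act omega_act1 omega_actM.

Lemma omega_cap_subproof (A B : Omega) : left_ideal (A :&: B).
Proof. by apply/left_idealP => n m; rewrite !inE => /andP[/ideal_closed-> /ideal_closed->]. Qed.
Definition omega_cap (A B : Omega) : Omega := Ideal (omega_cap_subproof A B).

Lemma omega_top_subproof : left_ideal setT.
Proof. by apply/left_idealP => n m _; rewrite inE. Qed.
Definition omegaT : Omega := Ideal omega_top_subproof.

Lemma char_subproof (E : Tset) (D : subTset E) (x : E) :
  left_ideal [set m | tact m x \in (D : {set E})].
Proof. by apply/left_idealP => n m; rewrite !inE tactM; apply: subset_ofP. Qed.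
Definition characteristic (E : Tset) (D : subTset E) (x : E) : Omega :=
  Ideal (char_subproof D x).

Record lt_topology : Type := LTTopology {
  lt_map :> Omega -> Omega;
  lt_equivariant : @equivariant Omega_Tset Omega_Tset lt_map;
  lt_top : lt_map omegaT = omegaT;
  lt_idem : forall B, lt_map (lt_map B) = lt_map B;
  lt_cap : forall A B, omega_cap (lt_map A) (lt_map B) = lt_map (omega_cap A B)
}.

Definition upgrade_set (j : lt_topology) (E : Tset) (D : subTset E) : {set E} :=
  [set x | j (characteristic D x) == omegaT].

Lemma upgrade_stable (j : lt_topology) (E : Tset) (D : subTset E) (m : triadic) (x : E) :
  x \in upgrade_set j D -> tact m x \in upgrade_set j D.
Proof.
rewrite !inE => /eqP jx; apply/eqP.
have -> : characteristic D (tact m x) = omega_act m (characteristic D x).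
  by apply/val_inj/setP => n; rewrite !inE tactM.
rewrite [LHS](@lt_equivariant j) jx.
by apply/val_inj/setP => n; rewrite !inE.
Qed.

Definition upgrade (j : lt_topology) (E : Tset) (D : subTset E) : subTset E :=
  SubTset (@upgrade_stable j E D).

Definition setC_id : {set triadic} := [set tconst0; tconst4; tconst7].
Definition setL_id : {set triadic} := setC_id :|: [set tf; (tf * tf)%g].
Definition setR_id : {set triadic} := setC_id :|: [set tg; (tg * tg)%g].
Definition setP_id : {set triadic} := setL_id :|: setR_id.

(** An element [z |-> m z + b] of the monoid is encoded by [(m, b)], which
    reduces statements about the monoid and its ideals to computations. *)
Definition code (t : triadic) : Z12 * Z12 := (t 1 - t 0, t 0).

Definition codes : seq (Z12 * Z12) :=
  [:: (1, 0); (3, 7); (9, 4); (8, 4); (4, 0); (0, 0); (0, 4); (0, 7)].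

Definition cmul (c d : Z12 * Z12) : Z12 * Z12 :=
  (c.1 * d.1, c.1 * d.2 + c.2).

Lemma Z12_all (Q : pred Z12) :
  all Q [:: 0; 1; 2; 3; 4; 5; 6; 7; 8; 9; 10; 11] -> forall z, Q z.
Proof.
move=> /allP hQ z; apply: hQ.
by case: z; do 12![case=> [|]; first by []].
Qed.

Lemma codeE (t : triadic) : t =1 affine (code t).1 (code t).2.
Proof.
have /andP[/existsP[m /existsP[b /eqP tE]] _] := triadicP t.
by move=> z; rewrite /= tE !ffunE mulr0 add0r mulr1 addrK.
Qed.

Lemma code_inj : injective code.
Proof. by move=> s t st; apply: triadic_eq => z; rewrite !codeE st. Qed.

Lemma code_affine m b (h : is_triadic (affine m b)) : code (Triadic h) = (m, b).
Proof. by rewrite /code /= !ffunE mulr0 add0r mulr1 addrK. Qed.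

Lemma code1 : code 1%g = (1, 0).
Proof. by rewrite /code !ffunE subr0. Qed.

Lemma codeM (s t : triadic) : code (s * t)%g = cmul (code s) (code t).
Proof.
have E z : (s * t)%g z = (code s).1 * t z + (code s).2 by rewrite ffunE codeE ffunE.
rewrite /cmul; rewrite {1}/code !E opprD addrACA subrr addr0 -mulrBr.
by rewrite /code.
Qed.

Lemma code_mem (t : triadic) : code t \in codes.
Proof.
pose inC (z : Z12) := z \in [:: 0; 4; 7].
have key (m b : Z12) :
    [&& inC b, inC (m * 4 + b) & inC (m * 7 + b)] ==> ((m, b) \in codes).
  by apply: (Z12_all (Q := fun b => _ ==> ((m, b) \in codes))); move: m; apply: Z12_all; vm_compute.
have tC z : inC z -> inC (t z).
  move=> zC; have := @natural_C_stable t z.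
  by rewrite /inC !inE -!orbA in zC *; apply.
have := key (code t).1 (code t).2; rewrite -surjective_pairing => /implyP; apply.
apply/and3P; split; first exact: tC.
- by have := tC 4 isT; rewrite codeE ffunE.
- by have := tC 7 isT; rewrite codeE ffunE.
Qed.

Definition listC : seq (Z12 * Z12) := [:: (0, 0); (0, 4); (0, 7)].
Definition listL : seq (Z12 * Z12) := listC ++ [:: (3, 7); (9, 4)].
Definition listR : seq (Z12 * Z12) := listC ++ [:: (8, 4); (4, 0)].
Definition listP : seq (Z12 * Z12) := listL ++ listR.

Lemma code_const0 : code tconst0 = (0, 0). Proof. exact: code_affine. Qed.
Lemma code_const4 : code tconst4 = (0, 4). Proof. exact: code_affine. Qed.
Lemma code_const7 : code tconst7 = (0, 7). Proof. exact: code_affine. Qed.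
Lemma code_f : code tf = (3, 7). Proof. exact: code_affine. Qed.
Lemma code_g : code tg = (8, 4). Proof. exact: code_affine. Qed.
Lemma code_ff : code (tf * tf)%g = (9, 4).
Proof. by rewrite codeM code_f; apply/eqP; vm_compute. Qed.
Lemma code_gg : code (tg * tg)%g = (4, 0).
Proof. by rewrite codeM code_g; apply/eqP; vm_compute. Qed.

Definition codeEs :=
  (code_const0, code_const4, code_const7, code_f, code_g, code_ff, code_gg, code1).

Lemma mem_setC n : (n \in setC_id) = (code n \in listC).
Proof. by rewrite !inE -!(inj_eq code_inj) !codeEs -!orbA. Qed.
Lemma mem_setL n : (n \in setL_id) = (code n \in listL).
Proof. by rewrite inE mem_setC mem_cat !inE -!(inj_eq code_inj) !codeEs. Qed.
Lemma mem_setR n : (n \in setR_id) = (code n \in listR).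
Proof. by rewrite inE mem_setC mem_cat !inE -!(inj_eq code_inj) !codeEs. Qed.
Lemma mem_setP n : (n \in setP_id) = (code n \in listP).
Proof. by rewrite in_setU mem_setL mem_setR -mem_cat. Qed.

Lemma list_ideal (B : {set triadic}) (s : seq (Z12 * Z12)) :
  (forall n, (n \in B) = (code n \in s)) ->
  all (fun c => all (fun d => (d \in s) ==> (cmul c d \in s)) codes) codes ->
  left_ideal B.
Proof.
move=> Bs /allP sP; apply/left_idealP => n m; rewrite !Bs codeM => mB.
by have /allP/(_ _ (code_mem m))/implyP := sP _ (code_mem n); apply.
Qed.

Lemma set0_ideal : left_ideal set0.
Proof. by apply/left_idealP => n m; rewrite inE. Qed.
Lemma setC_ideal : left_ideal setC_id. Proof. by apply: (list_ideal mem_setC); vm_compute. Qed.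
Lemma setL_ideal : left_ideal setL_id. Proof. by apply: (list_ideal mem_setL); vm_compute. Qed.
Lemma setR_ideal : left_ideal setR_id. Proof. by apply: (list_ideal mem_setR); vm_compute. Qed.
Lemma setP_ideal : left_ideal setP_id. Proof. by apply: (list_ideal mem_setP); vm_compute. Qed.

Definition omega0 : Omega := Ideal set0_ideal.
Definition omegaC : Omega := Ideal setC_ideal.
Definition omegaL : Omega := Ideal setL_ideal.
Definition omegaR : Omega := Ideal setR_ideal.
Definition omegaP : Omega := Ideal setP_ideal.

Definition ideals : seq Omega := [:: omega0; omegaC; omegaL; omegaR; omegaP; omegaT].
Definition lists : seq (seq (Z12 * Z12)) := [:: [::]; listC; listL; listR; listP; codes].

Lemma mem_ideals i n :
  (i < 6)%N -> (n \in (nth omega0 ideals i : {set _})) = (code n \in nth [::] lists i).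
Proof.
case: i => [|[|[|[|[|[|//]]]]]] _ /=.
- by rewrite inE.
- exact: mem_setC.
- exact: mem_setL.
- exact: mem_setR.
- exact: mem_setP.
- by rewrite inE code_mem.
Qed.

Lemma code_surj c : c \in codes -> exists n, code n = c.
Proof.
rewrite !in_cons.
case/predU1P => [->|]; first by exists 1%g; rewrite codeEs.
case/predU1P => [->|]; first by exists tf; rewrite codeEs.
case/predU1P => [->|]; first by exists (tf * tf)%g; rewrite codeEs.
case/predU1P => [->|]; first by exists tg; rewrite codeEs.
case/predU1P => [->|]; first by exists (tg * tg)%g; rewrite codeEs.
case/predU1P => [->|]; first by exists tconst0; rewrite codeEs.
case/predU1P => [->|]; first by exists tconst4; rewrite codeEs.
case/predU1P => [->|]; first by exists tconst7; rewrite codeEs.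
by [].
Qed.

Lemma ideals_uniq : uniq ideals.
Proof.
have neq i k : (i < 6)%N -> (k < 6)%N ->
    has (fun c => (c \in nth [::] lists i) != (c \in nth [::] lists k)) codes ->
    nth omega0 ideals i != nth omega0 ideals k.
  move=> i6 k6 /hasP[c cc]; have [n <-] := code_surj cc.
  by rewrite -!mem_ideals //; apply: contraNneq => ->.
apply/(uniqPn omega0) => -[i [k [ik k6]]]; apply/eqP; apply: neq => //.
  exact: ltn_trans ik k6.
by case: k ik k6 => [|[|[|[|[|[|//]]]]]] //; case: i => [|[|[|[|[|//]]]]] // _ _; vm_compute.
Qed.

Lemma Omega_ideals (B : Omega) : B \in ideals.
Proof.
have [i i6 Bi] : exists2 i, (i < 6)%N &
    forall n, (n \in (B : {set _})) = (code n \in nth [::] lists i).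
  pose inB c := [exists n in (B : {set _}), code n == c].
  have inBE n : (n \in (B : {set _})) = inB (code n).
    apply/idP/exists_inP => [nB | [m mB /eqP/code_inj <-] //].
    by exists n.
  have inBM c d : d \in codes -> inB c -> inB (cmul d c).
    case/code_surj=> n <- /exists_inP[m mB /eqP <-]; apply/exists_inP.
    by exists (n * m)%g; rewrite ?codeM // ideal_closed.
  have sub c d e : e \in codes -> cmul e c = d -> inB c ==> inB d.
    by move=> ec <-; apply/implyP; apply: inBM.
  have imp c d : has (fun e => cmul e c == d) codes -> inB c ==> inB d.
    by case/hasP => e ec /eqP; apply: sub.
  have H1 c : c \in codes -> inB (1, 0) ==> inB c.
    by move=> cc; apply: imp; apply/hasP; exists c => //; case: c cc => m b _;
       rewrite /cmul /= mulr1 mulr0 add0r.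
  have Hf : inB (3, 7) ==> inB (9, 4) by apply: imp; vm_compute.
  have Hff : inB (9, 4) ==> inB (3, 7) by apply: imp; vm_compute.
  have Hg : inB (8, 4) ==> inB (4, 0) by apply: imp; vm_compute.
  have Hgg : inB (4, 0) ==> inB (8, 4) by apply: imp; vm_compute.
  have H04 : inB (0, 0) ==> inB (0, 4) by apply: imp; vm_compute.
  have H47 : inB (0, 4) ==> inB (0, 7) by apply: imp; vm_compute.
  have H70 : inB (0, 7) ==> inB (0, 0) by apply: imp; vm_compute.
  have Hf0 : inB (3, 7) ==> inB (0, 0) by apply: imp; vm_compute.
  have Hg0 : inB (8, 4) ==> inB (0, 0) by apply: imp; vm_compute.
  have Ha : inB (1, 0) ==> inB (0, 0) by apply: H1; vm_compute.
  have Hb : inB (1, 0) ==> inB (3, 7) by apply: H1; vm_compute.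
  have Hc : inB (1, 0) ==> inB (8, 4) by apply: H1; vm_compute.
  pose bits : seq (seq bool) := [::
     [:: false; false; false; false; false; false; false; false];
     [:: false; false; false; false; false; true; true; true];
     [:: false; true; true; false; false; true; true; true];
     [:: false; false; false; true; true; true; true; true];
     [:: false; true; true; true; true; true; true; true];
     [:: true; true; true; true; true; true; true; true]].
  have bitsE i : (i < 6)%N -> [seq c \in nth [::] lists i | c <- codes] = nth [::] bits i.
    by case: i => [|[|[|[|[|[|//]]]]]] _; vm_compute.
  suff [i i6] : exists2 i, (i < 6)%N & [seq inB c | c <- codes] = nth [::] bits i.
    rewrite -bitsE // => /eq_in_map ii; exists i => // n.
    by rewrite inBE; apply: ii; apply: code_mem.
  exists (if inB (1, 0)%R then 5 else if inB (3, 7)%R then (if inB (8, 4)%R then 4 else 2)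
    else if inB (8, 4)%R then 3 else if inB (0, 0)%R then 1 else 0)%N.
    by do !case: ifP.
  move: Hf Hff Hg Hgg H04 H47 H70 Hf0 Hg0 Ha Hb Hc; rewrite [map _ _]/=.
  by case: (inB (1, 0)); case: (inB (3, 7)); case: (inB (9, 4)); case: (inB (8, 4));
     case: (inB (4, 0)); case: (inB (0, 0)); case: (inB (0, 4)); case: (inB (0, 7)).
have -> : B = nth omega0 ideals i.
  by apply/val_inj/setP => n; rewrite Bi mem_ideals.
exact: mem_nth.
Qed.

Lemma in_ideals (s : seq nat) i : (i < 6)%N -> all (fun k => (k < 6)%N) s ->
  (nth omega0 ideals i \in [seq nth omega0 ideals k | k <- s]) = (i \in s).
Proof.
move=> i6; elim: s => //= k s IHs /andP[k6 s6].
by rewrite !inE nth_uniq ?ideals_uniq // IHs.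
Qed.

Definition act_index (c : Z12 * Z12) (i : nat) : nat :=
  find (fun k => all (fun n => (cmul n c \in nth [::] lists i)
                            == (n \in nth [::] lists k)) codes) (iota 0 6).

Definition cap_index (i k : nat) : nat :=
  find (fun l => all (fun n => ((n \in nth [::] lists i) && (n \in nth [::] lists k))
                            == (n \in nth [::] lists l)) codes) (iota 0 6).

Lemma find_iota6 (p : pred nat) : (find p (iota 0 6) < 6)%N -> p (find p (iota 0 6)).
Proof.
move=> lt6; have hp : has p (iota 0 6) by rewrite has_find size_iota.
by have := nth_find 0%N hp; rewrite nth_iota.
Qed.

Lemma act_indexP (m : triadic) i : (i < 6)%N -> (act_index (code m) i < 6)%N ->
  omega_act m (nth omega0 ideals i) = nth omega0 ideals (act_index (code m) i).
Proof.
move=> i6 lt6; apply/val_inj/setP => n; rewrite inE !mem_ideals // codeM.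
by apply/eqP; have /allP := find_iota6 lt6; apply; apply: code_mem.
Qed.

Lemma cap_indexP i k : (i < 6)%N -> (k < 6)%N -> (cap_index i k < 6)%N ->
  omega_cap (nth omega0 ideals i) (nth omega0 ideals k)
  = nth omega0 ideals (cap_index i k).
Proof.
move=> i6 k6 lt6; apply/val_inj/setP => n; rewrite inE !mem_ideals //.
by apply/eqP; have /allP := find_iota6 lt6; apply; apply: code_mem.
Qed.

Definition topology_check (J : seq nat) : bool :=
  [&& size J == 6, all (fun i => i < 6)%N J, nth 0%N J 5 == 5,
      all (fun i => nth 0%N J (nth 0%N J i) == nth 0%N J i) (iota 0 6),
      all (fun c => all (fun i =>
        (act_index c i < 6)%N && (act_index c (nth 0%N J i) == nth 0%N J (act_index c i)))
          (iota 0 6)) codes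
    & all (fun i => all (fun k =>
        (cap_index i k < 6)%N &&
        (cap_index (nth 0%N J i) (nth 0%N J k) == nth 0%N J (cap_index i k)))
          (iota 0 6)) (iota 0 6)].

Section Topology.
Variables (j : Omega -> Omega) (J : seq nat).
Hypothesis jJ : forall i, (i < 6)%N -> j (nth omega0 ideals i) = nth omega0 ideals (nth 0%N J i).
Hypothesis Jok : topology_check J.

Lemma check_bound i : (i < 6)%N -> (nth 0%N J i < 6)%N.
Proof.
by case/and5P: Jok => /eqP sJ /allP bJ _ _ _ i6; apply/bJ/mem_nth; rewrite sJ.
Qed.

Lemma ideal_nth (B : Omega) : exists2 i, (i < 6)%N & B = nth omega0 ideals i.
Proof. by have /(nthP omega0)[i i6 <-] := Omega_ideals B; exists i. Qed.

Lemma check_top : j omegaT = omegaT.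
Proof. by case/and5P: Jok => _ _ /eqP J5 _ _; rewrite [LHS](jJ (isT : 5 < 6)%N) J5. Qed.

Lemma check_idem B : j (j B) = j B.
Proof.
have [i i6 ->] := ideal_nth B; case/and5P: Jok => _ _ _ /allP idJ _.
rewrite !jJ ?check_bound //; congr nth; apply/eqP/idJ.
by rewrite mem_iota.
Qed.

Lemma check_equivariant : @equivariant Omega_Tset Omega_Tset j.
Proof.
move=> m B /=; have [i i6 ->] := ideal_nth B.
case/and5P: Jok => _ _ _ _ /andP[/allP eqJ _].
have at6 k : (k < 6)%N -> (act_index (code m) k < 6)%N /\
    act_index (code m) (nth 0%N J k) = nth 0%N J (act_index (code m) k).
  move=> k6; have /allP eqk := eqJ _ (code_mem m).
  by have := eqk k; rewrite mem_iota => /(_ k6) /andP[-> /eqP ->].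
have [a6 aE] := at6 i i6.
by rewrite jJ // !act_indexP ?check_bound // ?jJ ?aE ?check_bound.
Qed.

Lemma check_cap A B : omega_cap (j A) (j B) = j (omega_cap A B).
Proof.
have [i i6 ->] := ideal_nth A; have [k k6 ->] := ideal_nth B.
case/and5P: Jok => _ _ _ _ /andP[_ /allP capJ].
have := capJ i; rewrite mem_iota => /(_ i6) /allP capk.
have := capk k; rewrite mem_iota => /(_ k6) /andP[c6 /eqP cE].
by rewrite !jJ // !cap_indexP ?check_bound // ?jJ ?cE ?check_bound.
Qed.

Definition make_topology : lt_topology :=
  LTTopology check_equivariant check_top check_idem check_cap.
End Topology.

(** In the three tables below the last branch covers only the empty ideal, by
    [Omega_ideals]. *)
Definition jP_map (B : Omega) : Omega :=
  if B \in [:: omegaT; omegaP] then omegaT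
  else if B == omegaL then omegaL
  else if B == omegaR then omegaR
  else if B == omegaC then omegaC
  else omega0.

Definition jL_map (B : Omega) : Omega :=
  if B \in [:: omegaT; omegaP; omegaL] then omegaT
  else if B \in [:: omegaR; omegaC] then omegaR
  else omega0.

Definition jR_map (B : Omega) : Omega :=
  if B \in [:: omegaT; omegaP; omegaR] then omegaT
  else if B \in [:: omegaL; omegaC] then omegaL
  else omega0.

Lemma jP_mapE i : (i < 6)%N -> jP_map (nth omega0 ideals i)
  = nth omega0 ideals (nth 0%N [:: 0; 1; 2; 3; 5; 5]%N i).
Proof.
move=> i6; rewrite /jP_map -!mem_seq1 (@in_ideals [:: 5; 4]%N) //.
rewrite (@in_ideals [:: 2]%N) // (@in_ideals [:: 3]%N) // (@in_ideals [:: 1]%N) //.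
by case: i i6 => [|[|[|[|[|[|//]]]]]].
Qed.

Lemma jL_mapE i : (i < 6)%N -> jL_map (nth omega0 ideals i)
  = nth omega0 ideals (nth 0%N [:: 0; 3; 5; 3; 5; 5]%N i).
Proof.
move=> i6; rewrite /jL_map (@in_ideals [:: 5; 4; 2]%N) // (@in_ideals [:: 3; 1]%N) //.
by case: i i6 => [|[|[|[|[|[|//]]]]]].
Qed.

Lemma jR_mapE i : (i < 6)%N -> jR_map (nth omega0 ideals i)
  = nth omega0 ideals (nth 0%N [:: 0; 2; 2; 5; 5; 5]%N i).
Proof.
move=> i6; rewrite /jR_map (@in_ideals [:: 5; 4; 3]%N) // (@in_ideals [:: 2; 1]%N) //.
by case: i i6 => [|[|[|[|[|[|//]]]]]].
Qed.

Lemma jP_check : topology_check [:: 0; 1; 2; 3; 5; 5]%N. Proof. by vm_compute. Qed.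
Lemma jL_check : topology_check [:: 0; 3; 5; 3; 5; 5]%N. Proof. by vm_compute. Qed.
Lemma jR_check : topology_check [:: 0; 2; 2; 5; 5; 5]%N. Proof. by vm_compute. Qed.

Definition jP : lt_topology := make_topology jP_mapE jP_check.
Definition jL : lt_topology := make_topology jL_mapE jL_check.
Definition jR : lt_topology := make_topology jR_mapE jR_check.

Definition major_set (n : Z12) : {set Z12} := [set n; n + 4; n + 7].
Definition minor_set (n : Z12) : {set Z12} := [set n; n + 3; n + 7].

Definition consonant (Y : {set Z12}) : bool :=
  [exists n, (Y == major_set n) || (Y == minor_set n)].

Record triad : Type := Triad { triad_set :> {set Z12}; _ : consonant triad_set }.

HB.instance Definition _ := [isSub for triad_set].
HB.instance Definition _ := [Finite of triad by <:].

Lemma major_consonant n : consonant (major_set n).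
Proof. by apply/existsP; exists n; rewrite eqxx. Qed.
Lemma minor_consonant n : consonant (minor_set n).
Proof. by apply/existsP; exists n; rewrite eqxx orbT. Qed.

Definition major (n : Z12) : triad := Triad (major_consonant n).
Definition minor (n : Z12) : triad := Triad (minor_consonant n).

Definition maximal_cover (S : {set Z12}) : {set triad} :=
  [set Y : triad | (Y : {set Z12}) \subset S].

Definition image_collection (phi : Z12 -> Z12) (S : {set triad}) : {set {set Z12}} :=
  [set phi @: (Y : {set Z12}) | Y : triad in S].

(** [exchange u v] swaps [u n] and [v n] for every [n]; the transpositions
    composed here are disjoint when all the [u n] and [v n] are distinct, see
    [exchange_l] and [exchange_r]. *)
Definition exchange (u v : Z12 -> triad) : {perm triad} :=
  (\prod_(n : Z12) tperm (u n) (v n))%g.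

(** The triad [{n+4, n+7, n+11}] is [minor (n + 4)], and [{n+9, n, n+4}] is
    [minor (n + 9)]; see [minor_L] and [minor_R]. *)
Definition opP : {perm triad} := exchange major minor.
Definition opL : {perm triad} := exchange major (fun n => minor (n + 4)).
Definition opR : {perm triad} := exchange major (fun n => minor (n + 9)).

Lemma minor_L n : minor (n + 4) = [set n + 4; n + 7; n + 11] :> {set Z12}.
Proof.
rewrite -[LHS]/[set n + 4; n + 4 + 3; n + 4 + 7] -!(addrA n).
have -> : 4 + 3 = 7 :> Z12 by apply/eqP; vm_compute.
by have -> : 4 + 7 = 11 :> Z12 by apply/eqP; vm_compute.
Qed.

Lemma minor_R n : minor (n + 9) = [set n + 9; n; n + 4] :> {set Z12}.
Proof.
rewrite -[LHS]/[set n + 9; n + 9 + 3; n + 9 + 7] -!(addrA n).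
have -> : 9 + 3 = 0 :> Z12 by apply/eqP; vm_compute.
have -> : 9 + 7 = 4 :> Z12 by apply/eqP; vm_compute.
by rewrite addr0.
Qed.

Section Exchange.
Variables u v : Z12 -> triad.
Hypotheses (ui : injective u) (vi : injective v) (uv : forall i k, u i != v k).

Lemma exchange_seq (r : seq Z12) k : uniq r ->
  ((\prod_(n <- r) tperm (u n) (v n))%g (u k) = (if k \in r then v k else u k)) *
  ((\prod_(n <- r) tperm (u n) (v n))%g (v k) = (if k \in r then u k else v k)).
Proof.
have vu i l : (v i == u l) = false by rewrite eq_sym; apply/negbTE.
have uv' i l : (u i == v l) = false by apply/negbTE.
elim: r k => [|i r IHr] k /=; first by rewrite big_nil !perm1.
case/andP=> ir ur; rewrite big_cons !permM !inE.
case: (eqVneq k i) => [-> | ki] /=.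
  by rewrite tpermL tpermR !IHr // (negbTE ir).
by rewrite !tpermD ?(inj_eq ui) ?(inj_eq vi) ?uv' ?vu // 1?eq_sym // !IHr.
Qed.

Lemma exchange_l k : exchange u v (u k) = v k.
Proof. by rewrite exchange_seq ?index_enum_uniq ?mem_index_enum. Qed.
Lemma exchange_r k : exchange u v (v k) = u k.
Proof. by rewrite exchange_seq ?index_enum_uniq ?mem_index_enum. Qed.
End Exchange.

Lemma major_minor_neq i k : major i != minor k.
Proof.
pose Q (i k : Z12) := has (fun z : Z12 => (z \in [:: i; i + 4; i + 7])
  != (z \in [:: k; k + 3; k + 7])) [:: i; i + 4; i + 7; k; k + 3; k + 7].
have /hasP[z _ zP] : Q i k.
  by apply: (Z12_all (Q := Q i)); move: i; apply: Z12_all; vm_compute.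
apply: contraNneq zP => /(congr1 val)/setP/(_ z).
by rewrite !inE -!orbA => ->.
Qed.

Lemma major_inj : injective major.
Proof.
pose Q (i k : Z12) := (i == k) || has (fun z : Z12 => (z \in [:: i; i + 4; i + 7])
  != (z \in [:: k; k + 4; k + 7])) [:: i; i + 4; i + 7; k; k + 4; k + 7].
move=> i k /(congr1 val)/setP ik; apply/eqP.
have /orP[// | /hasP[z _]] : Q i k.
  by apply: (Z12_all (Q := Q i)); move: i {ik}; apply: Z12_all; vm_compute.
by have := ik z; rewrite !inE -!orbA => ->; rewrite eqxx.
Qed.

Lemma minor_inj : injective minor.
Proof.
pose Q (i k : Z12) := (i == k) || has (fun z : Z12 => (z \in [:: i; i + 3; i + 7])
  != (z \in [:: k; k + 3; k + 7])) [:: i; i + 3; i + 7; k; k + 3; k + 7].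
move=> i k /(congr1 val)/setP ik; apply/eqP.
have /orP[// | /hasP[z _]] : Q i k.
  by apply: (Z12_all (Q := Q i)); move: i {ik}; apply: Z12_all; vm_compute.
by have := ik z; rewrite !inE -!orbA => ->; rewrite eqxx.
Qed.

Lemma opPE n : (opP (major n) = minor n) * (opP (minor n) = major n).
Proof.
by split; [apply: exchange_l | apply: exchange_r];
  [exact: major_inj | exact: minor_inj | exact: major_minor_neq
  |exact: major_inj | exact: minor_inj | exact: major_minor_neq].
Qed.

Lemma minorD_inj b : injective (fun n => minor (n + b)).
Proof. by move=> i k /minor_inj/addIr. Qed.

Lemma opLE n : (opL (major n) = minor (n + 4)) * (opL (minor (n + 4)) = major n).
Proof.
have ne i k : major i != minor (k + 4) by exact: major_minor_neq.
by split; [exact: (exchange_l major_inj (@minorD_inj 4) ne)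
  | exact: (exchange_r major_inj (@minorD_inj 4) ne)].
Qed.

Lemma opRE n : (opR (major n) = minor (n + 9)) * (opR (minor (n + 9)) = major n).
Proof.
have ne i k : major i != minor (k + 9) by exact: major_minor_neq.
by split; [exact: (exchange_l major_inj (@minorD_inj 9) ne)
  | exact: (exchange_r major_inj (@minorD_inj 9) ne)].
Qed.

Definition PLR : {group {perm triad}} := [group of <<[set opP; opL; opR]>>%g].

Definition simply_transitive (H : {set {perm triad}}) (S : {set triad}) : Prop :=
  (forall h : {perm triad}, h \in H -> h @: S = S) /\
  (forall X Y, X \in S -> Y \in S -> exists! h : {perm triad}, h \in H /\ h X = Y).

(* Main.v *)
Require Import Defs.
From mathcomp Require Import all_boot all_order all_algebra all_fingroup.
From mathcomp Require Import ring.

Import GRing.Theory GroupScope.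
Local Open Scope ring_scope.

(** Conjugating by [phi] identifies the two characteristic morphisms, so every
    upgrade is transported by [phi].  The [T/I]-group acts on the consonant triads
    and commutes with the [PLR]-group, so simple transitivity of a subgroup of the
    latter is transported too.  As the [T/I]-group is transitive on triads, any
    subgroup of the [PLR]-group acts freely, hence simply transitively on each of
    its orbits, and the three natural covers are the orbits of [{0,4,7}]. *)

(** * Upgrades: transport along [phi] and the three natural carriers *)

Lemma characteristic_conj (phi : {perm Z12}) (x : Z12) :
  Defs.characteristic (conj_C phi) (phi x) = Defs.characteristic natural_C x.
Proof.
apply/val_inj/setP => m; rewrite !in_set /= /mu permK.
by rewrite (mem_imset _ _ (@perm_inj _ phi)) !inE.
Qed.

Lemma upgrade_conj (j : lt_topology) (phi : {perm Z12}) :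
  (upgrade j (conj_C phi) : {set Z12}) = phi @: (upgrade j natural_C : {set Z12}).
Proof.
apply/setP => y; rewrite -[y](permKV phi) (mem_imset _ _ (@perm_inj _ phi)).
by rewrite !inE characteristic_conj.
Qed.

Lemma nth_idealsT i : (i < 6)%N -> (nth omega0 ideals i == omegaT) = (i == 5%N).
Proof.
by move=> i6; rewrite -[omegaT]/(nth omega0 ideals 5) nth_uniq ?ideals_uniq.
Qed.

(** Of the six ideals only [omegaP] and [omegaT] contain both generators of the monoid. A point
    therefore lies in the upgrade as soon as [tf] and [tg] send it into the triad, which leaves a
    test over twelve values. For [jL] and [jR] one generator suffices. *)
Lemma jP_eqT (B : Omega) :
  (jP B == omegaT) = (tf \in (B : {set _})) && (tg \in (B : {set _})).
Proof.
have [i i6 ->] := ideal_nth B; rewrite [jP _]jP_mapE // !mem_ideals // code_f code_g.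
by case: i i6 => [|[|[|[|[|[|//]]]]]] _; rewrite nth_idealsT.
Qed.

Lemma jL_eqT (B : Omega) : (jL B == omegaT) = (tf \in (B : {set _})).
Proof.
have [i i6 ->] := ideal_nth B; rewrite [jL _]jL_mapE // !mem_ideals // code_f.
by case: i i6 => [|[|[|[|[|[|//]]]]]] _; rewrite nth_idealsT.
Qed.

Lemma jR_eqT (B : Omega) : (jR B == omegaT) = (tg \in (B : {set _})).
Proof.
have [i i6 ->] := ideal_nth B; rewrite [jR _]jR_mapE // !mem_ideals // code_g.
by case: i i6 => [|[|[|[|[|[|//]]]]]] _; rewrite nth_idealsT.
Qed.

Lemma upgrade_jP : (upgrade jP natural_C : {set Z12}) = [set z in [:: 0; 3; 4; 7]].
Proof.
apply/setP => x; rewrite !in_set jP_eqT !in_set /= !ffunE !inE; apply/eqP.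
by move: x; apply: Z12_all; vm_compute.
Qed.

Lemma upgrade_jL :
  (upgrade jL natural_C : {set Z12}) = [set z in [:: 0; 3; 4; 7; 8; 11]].
Proof.
apply/setP => x; rewrite !in_set jL_eqT !in_set /= !ffunE !inE; apply/eqP.
by move: x; apply: Z12_all; vm_compute.
Qed.

Lemma upgrade_jR :
  (upgrade jR natural_C : {set Z12}) = [set z in [:: 0; 1; 3; 4; 6; 7; 9; 10]].
Proof.
apply/setP => x; rewrite !in_set jR_eqT !in_set /= !ffunE !inE; apply/eqP.
by move: x; apply: Z12_all; vm_compute.
Qed.

(** * The [TI] action on triads and its commutation with [PLR] *)

Lemma triadP (Y : triad) : exists k, Y = major k \/ Y = minor k.
Proof.
have /existsP[k /orP[/eqP e | /eqP e]] := valP Y; exists k; [left | right];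
  exact: val_inj.
Qed.

Lemma opL_minor k : opL (minor k) = major (k - 4).
Proof. by have [_] := opLE (k - 4); rewrite subrK. Qed.

Lemma opR_minor k : opR (minor k) = major (k - 9).
Proof. by have [_] := opRE (k - 9); rewrite subrK. Qed.

Lemma transp_major n k : transp n @: major k = major (k + n) :> {set Z12}.
Proof. by rewrite !imsetU !imset_set1 !permE /= /major_set (addrAC k 4) (addrAC k 7). Qed.

Lemma transp_minor n k : transp n @: minor k = minor (k + n) :> {set Z12}.
Proof. by rewrite !imsetU !imset_set1 !permE /= /minor_set (addrAC k 3) (addrAC k 7). Qed.

(** Inversion reverses the order of the notes: the fifth [k + 7] goes to the new root, and the third
    at distance 4 from the root becomes one at distance 7 - 4 = 3. *)
Lemma inversion_major n k :
  inversion n @: major k = minor (n - k - 7) :> {set Z12}.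
Proof.
rewrite !imsetU !imset_set1 !permE /= /minor_set.
have -> : - k + n = n - k - 7 + 7 by ring.
have -> : - (k + 4) + n = n - k - 7 + 3 by ring.
have -> : - (k + 7) + n = n - k - 7 by ring.
by apply/setP => z; rewrite !inE [LHS]orbC orbA [LHS]orbAC.
Qed.

Lemma inversion_minor n k :
  inversion n @: minor k = major (n - k - 7) :> {set Z12}.
Proof.
rewrite !imsetU !imset_set1 !permE /= /major_set.
have -> : - k + n = n - k - 7 + 7 by ring.
have -> : - (k + 3) + n = n - k - 7 + 4 by ring.
have -> : - (k + 7) + n = n - k - 7 by ring.
by apply/setP => z; rewrite !inE [LHS]orbC orbA [LHS]orbAC.
Qed.

Lemma TI_consonant phi (Y : triad) : phi \in TI -> consonant (phi @: Y).
Proof.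
have [k [] ->] := triadP Y; rewrite inE => /orP[] /imsetP[n _ ->].
- by rewrite transp_major (valP (major _)).
- by rewrite inversion_major (valP (minor _)).
- by rewrite transp_minor (valP (minor _)).
- by rewrite inversion_minor (valP (major _)).
Qed.

(** Places the [TI] action in the same permutation group as [PLR], so that commutation can be
    phrased with centralisers. *)
Lemma TI_triad_perm phi : phi \in TI ->
  exists theta : {perm triad}, forall Y, theta Y = phi @: Y :> {set Z12}.
Proof.
move=> phiTI; pose f (Y : triad) : triad := Triad (TI_consonant phi Y phiTI).
have f_inj : injective f.
  by move=> X Y /(congr1 val) /= /(imset_inj (@perm_inj _ phi)) /val_inj.
by exists (perm f_inj) => Y; rewrite permE.
Qed.

(** A centraliser is a group, so the three generators suffice. Transpositions shift all roots
    equally. Inversions negate roots and swap modes, while [opL] and [opR] move the roots of major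
    and minor triads by opposite amounts, so the two sign changes cancel. *)
Lemma TI_PLR_commute (phi : {perm Z12}) (theta : {perm triad}) : phi \in TI ->
  (forall Y, theta Y = phi @: Y :> {set Z12}) -> PLR \subset 'C[theta]%g.
Proof.
move=> phiTI thetaE; rewrite gen_subG.
have gen (h : {perm triad}) :
    (forall k, h (theta (major k)) = theta (h (major k))
            /\ h (theta (minor k)) = theta (h (minor k))) -> h \in 'C[theta]%g.
  move=> hk; apply/cent1P/permP => Y; rewrite !permM.
  by have [k [] ->] := triadP Y; have [] := hk k.
move: phiTI; rewrite inE => /orP[] /imsetP[n _ phiE].
- have tM k : theta (major k) = major (k + n).
    by apply/val_inj; rewrite /= thetaE phiE transp_major.
  have tm k : theta (minor k) = minor (k + n).
    by apply/val_inj; rewrite /= thetaE phiE transp_minor.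
  apply/subsetP => h /setUP[/set2P[]|/set1P] ->; apply: gen => k.
  + by rewrite tM tm !opPE tM tm.
  + by rewrite tM tm !opLE !opL_minor tM tm; split; congr (_ _); ring.
  + by rewrite tM tm !opRE !opR_minor tM tm; split; congr (_ _); ring.
- have tM k : theta (major k) = minor (n - k - 7).
    by apply/val_inj; rewrite /= thetaE phiE inversion_major.
  have tm k : theta (minor k) = major (n - k - 7).
    by apply/val_inj; rewrite /= thetaE phiE inversion_minor.
  apply/subsetP => h /setUP[/set2P[]|/set1P] ->; apply: gen => k.
  + by rewrite tM tm !opPE tM tm.
  + by rewrite tM tm !opLE !opL_minor tM tm; split; congr (_ _); ring.
  + by rewrite tM tm !opRE !opR_minor tM tm; split; congr (_ _); ring.
Qed.

Lemma TI_transitive (Y : triad) :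
  exists2 phi, phi \in TI & Y = phi @: major 0 :> {set Z12}.
Proof.
have [k [] ->] := triadP Y.
- exists (transp k); last by rewrite transp_major add0r.
  by rewrite inE imset_f.
(* [inversion n] sends [major 0] to the minor triad on [n - 7], hence the choice [n = k + 7]. *)
- exists (inversion (k + 7)); last by rewrite inversion_major subr0 addrK.
  by rewrite inE imset_f ?orbT.
Qed.

(** * Freeness and simple transitivity *)

Lemma PLR_free (h : {perm triad}) X : h \in PLR -> h X = X -> h = 1%g.
Proof.
move=> hPLR hX.
have comm Y : exists2 theta : {perm triad}, theta (major 0) = Y
    & forall Z, h (theta Z) = theta (h Z).
  have [phi phiTI YE] := TI_transitive Y.
  have [theta thetaE] := TI_triad_perm phi phiTI.
  exists theta; first by apply/val_inj; rewrite /= thetaE YE.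
  have /cent1P c := subsetP (TI_PLR_commute phi theta phiTI thetaE) h hPLR.
  by move=> Z; have /permP/(_ Z) := c; rewrite !permM.
(* The fixed point [X] is pulled back to [major 0] by a map commuting with [h]; from there such maps
   spread it to every triad. *)
have h0 : h (major 0) = major 0.
  have [theta tX tc] := comm X.
  by apply: (@perm_inj _ theta); rewrite -tc tX.
by apply/permP => Y; rewrite perm1; have [theta <- ->] := comm Y; rewrite h0.
Qed.

Lemma simply_transitive_orbit (H : {group {perm triad}}) X :
  H \subset PLR -> simply_transitive H (orbit 'P H X).
Proof.
move=> HPLR; split=> [h hH | Y Z].
  apply/eqP; rewrite eqEcard card_imset ?leqnn ?andbT; last exact: perm_inj.
  apply/subsetP => _ /imsetP[Y /orbitP[y yH <-] ->]; apply/orbitP.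
  by exists (y * h)%g; rewrite ?groupM //= /aperm permM.
move=> /orbitP[y yH <-] /orbitP[z zH <-]; rewrite /= /aperm.
exists (y^-1 * z)%g; split; first by rewrite groupM ?groupV // permM permK.
(* Products act from left to right: [y * h * z^-1] carries [X] to its image under [y], then to its
   image under [z], then back to [X], so freeness makes it trivial. *)
move=> h [hH hE]; have yhz : (y * h * z^-1)%g = 1%g.
  apply: (PLR_free _ X); last by rewrite !permM hE permK.
  by rewrite (subsetP HPLR) // !groupM ?groupV.
by apply: (mulgI y); rewrite mulKVg; apply: (mulIg (z^-1)%g); rewrite yhz mulgV.
Qed.

Lemma simply_transitive_imset (H : {set {perm triad}}) (theta : {perm triad})
    (S : {set triad}) :
  H \subset 'C[theta]%g ->
  simply_transitive H (theta @: S) <-> simply_transitive H S.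
Proof.
move=> Hc; have comm h Y : h \in H -> h (theta Y) = theta (h Y).
  by move/(subsetP Hc)/cent1P/permP/(_ Y); rewrite !permM.
have theta_inj := @perm_inj _ theta.
have imc h : h \in H -> h @: (theta @: S) = theta @: (h @: S).
  by move=> hH; rewrite -!imset_comp; apply: eq_imset => Y /=; apply: comm.
split=> -[stab trans]; split.
- by move=> h hH; apply: (imset_inj theta_inj); rewrite -imc // stab.
- move=> X Y XS YS.
  have [h [[hH hX] hu]] := trans _ _ (imset_f theta XS) (imset_f theta YS).
  exists h; split; first by split=> //; apply: theta_inj; rewrite -comm.
  by move=> k [kH kX]; apply: hu; rewrite comm // kX.
- by move=> h hH; rewrite imc // stab.
- move=> _ _ /imsetP[X XS ->] /imsetP[Y YS ->].
  have [h [[hH hX] hu]] := trans _ _ XS YS.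
  exists h; split; first by rewrite comm // hX.
  by move=> k [kH kX]; apply: hu; split=> //; apply: theta_inj; rewrite -comm.
Qed.

(** * Maximal covers: transport and computable membership *)

Lemma maximal_cover_imset (phi : {perm Z12}) (theta : {perm triad}) (S : {set Z12}) :
  (forall Y, theta Y = phi @: Y :> {set Z12}) ->
  maximal_cover (phi @: S) = theta @: maximal_cover S.
Proof.
move=> thetaE; apply/setP => Y; rewrite -[Y](permKV theta).
rewrite (mem_imset _ _ (@perm_inj _ theta)) !in_set thetaE.
apply/idP/idP => [|]; last exact: imsetS.
move=> sub; apply/subsetP => x xY; have := subsetP sub (phi x) (imset_f phi xY).
by rewrite (mem_imset _ _ (@perm_inj _ phi)).
Qed.

Lemma maximal_cover_major (s : seq Z12) k :
  (major k \in maximal_cover [set z in s]) = all (mem s) [:: k; k + 4; k + 7].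
Proof.
by rewrite in_set !subUset !sub1set !in_set /= andbT andbA.
Qed.

Lemma maximal_cover_minor (s : seq Z12) k :
  (minor k \in maximal_cover [set z in s]) = all (mem s) [:: k; k + 3; k + 7].
Proof.
by rewrite in_set !subUset !sub1set !in_set /= andbT andbA.
Qed.

(** * The natural covers as orbits of [major 0] *)

Lemma orbit_gen (A : {set {perm triad}}) (h : {perm triad}) X Y :
  h \in A -> Y \in orbit 'P <<A>>%g X -> h Y \in orbit 'P <<A>>%g X.
Proof.
move=> hA /orbitP[y yA <-]; apply/orbitP; exists (y * h)%g.
  by rewrite groupM // mem_gen.
by rewrite /= /aperm permM.
Qed.

(** A set stable under the generators contains the orbit of each of its points. Conversely, [opP]
    pairs the major and minor triads on a common root, so only the major triads of [S] have to be
    reached. *)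
Lemma eq_orbit_gen (A : {set {perm triad}}) (S : {set triad}) :
  opP \in A -> major 0 \in S ->
  (forall h k, h \in A -> (major k \in S -> h (major k) \in S) /\
                          (minor k \in S -> h (minor k) \in S)) ->
  (forall k, major k \in S -> major k \in orbit 'P <<A>>%g (major 0)) ->
  S = orbit 'P <<A>>%g (major 0).
Proof.
move=> PA S0 stab reach; apply/eqP; rewrite eqEsubset; apply/andP; split.
  apply/subsetP => Y; have [k [] ->] := triadP Y; first exact: reach.
  move=> kS; rewrite -(opPE k); apply: (orbit_gen _ _ _ _ PA).
  by apply: reach; have [_ /(_ kS)] := stab _ k PA; rewrite opPE.
rewrite acts_sub_orbit // gen_subG; apply/subsetP => h hA.
rewrite inE in_setT inE; apply/subsetP => Y; rewrite inE /= /aperm.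
by have [k [] ->] := triadP Y; have [] := stab _ k hA.
Qed.

Lemma cover_jP :
  maximal_cover [set z in [:: 0; 3; 4; 7]] = orbit 'P <<[set opP]>>%g (major 0).
Proof.
apply: eq_orbit_gen.
- exact: set11.
- by rewrite maximal_cover_major; vm_compute.
- move=> h k /set1P ->.
  rewrite !opPE maximal_cover_major maximal_cover_minor; split; apply/implyP;
  by move: k; apply: Z12_all; vm_compute.
- move=> k; rewrite maximal_cover_major => kS.
  (* The carrier contains a single major triad, [major 0] itself. *)
  suff /implyP/(_ kS)/eqP -> :
      all (mem [:: 0; 3; 4; 7]) [:: k; k + 4; k + 7] ==> (k == 0) by apply: orbit_refl.
  by move: k {kS}; apply: Z12_all; vm_compute.
Qed.

(** The carrier is a hexatonic collection, whose six triads form one cycle under alternating [opP]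
    and [opL]. *)
Lemma cover_jL :
  maximal_cover [set z in [:: 0; 3; 4; 7; 8; 11]] =
  orbit 'P <<[set opP; opL]>>%g (major 0).
Proof.
apply: eq_orbit_gen.
- exact: set21.
- by rewrite maximal_cover_major; vm_compute.
- move=> h k /set2P[] ->.
    rewrite !opPE maximal_cover_major maximal_cover_minor; split; apply/implyP;
    by move: k; apply: Z12_all; vm_compute.
  rewrite !opLE opL_minor !maximal_cover_major !maximal_cover_minor.
  by split; apply/implyP; move: k; apply: Z12_all; vm_compute.
- move=> k; rewrite maximal_cover_major => kS.
  set O := orbit 'P <<[set opP; opL]>>%g (major 0).
  have O0 : major 0 \in O by apply: orbit_refl.
  (* [opP] followed by [opL] lowers the root of a major triad by 4. Starting at 0 this visits the
     roots 0, 8, 4, which are all the major roots of the cover. *)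
  have OS n : major n \in O -> major (n - 4) \in O.
    move=> nO; rewrite -opL_minor -(opPE n).
    by do 2![apply: orbit_gen; rewrite ?set21 ?set22 //].
  have /implyP/(_ kS) : all (mem [:: 0; 3; 4; 7; 8; 11]) [:: k; k + 4; k + 7] ==>
      (k \in [:: 0; 0 - 4; 0 - 4 - 4]).
    by move: k {kS}; apply: Z12_all; vm_compute.
  have O1 := OS _ O0; have O2 := OS _ O1.
  by rewrite !in_cons => /or4P[] // /eqP ->.
Qed.

(** The carrier is an octatonic collection, whose eight triads form one cycle under alternating
    [opP] and [opR]. *)
Lemma cover_jR :
  maximal_cover [set z in [:: 0; 1; 3; 4; 6; 7; 9; 10]] =
  orbit 'P <<[set opP; opR]>>%g (major 0).
Proof.
apply: eq_orbit_gen.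
- exact: set21.
- by rewrite maximal_cover_major; vm_compute.
- move=> h k /set2P[] ->.
    rewrite !opPE maximal_cover_major maximal_cover_minor; split; apply/implyP;
    by move: k; apply: Z12_all; vm_compute.
  rewrite !opRE opR_minor !maximal_cover_major !maximal_cover_minor.
  by split; apply/implyP; move: k; apply: Z12_all; vm_compute.
- move=> k; rewrite maximal_cover_major => kS.
  set O := orbit 'P <<[set opP; opR]>>%g (major 0).
  have O0 : major 0 \in O by apply: orbit_refl.
  (* Lowering by 9 is raising by 3 modulo 12, so the major roots reached are 0, 3, 6, 9. *)
  have OS n : major n \in O -> major (n - 9) \in O.
    move=> nO; rewrite -opR_minor -(opPE n).
    by do 2![apply: orbit_gen; rewrite ?set21 ?set22 //].
  have /implyP/(_ kS) : all (mem [:: 0; 1; 3; 4; 6; 7; 9; 10]) [:: k; k + 4; k + 7] ==>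
      (k \in [:: 0; 0 - 9; 0 - 9 - 9; 0 - 9 - 9 - 9]).
    by move: k {kS}; apply: Z12_all; vm_compute.
  have O1 := OS _ O0; have O2 := OS _ O1; have O3 := OS _ O2.
  by rewrite !in_cons => /orP[|/or4P[]] // /eqP ->.
Qed.

Theorem corollary4p2 (phi : {perm Z12}) (phiTI : phi \in TI) :
  (forall j : lt_topology, j = jP \/ j = jL \/ j = jR ->
    [/\ exists H : {group {perm triad}},
          H \subset PLR /\
          simply_transitive H (maximal_cover (upgrade j (conj_C phi))),
        (upgrade j (conj_C phi) : {set Z12}) =
          phi @: (upgrade j natural_C : {set Z12}),
        [set (Y : {set Z12}) | Y : triad in maximal_cover (upgrade j (conj_C phi))] =
          image_collection phi (maximal_cover (upgrade j natural_C))
      & forall H : {group {perm triad}}, H \subset PLR ->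
          simply_transitive H (maximal_cover (upgrade j (conj_C phi))) <->
          simply_transitive H (maximal_cover (upgrade j natural_C))])
  /\
  [/\ (upgrade jP (conj_C phi) : {set Z12}) = phi @: [set 0; 3; 4; 7] /\
        simply_transitive <<[set opP]>>%G
          (maximal_cover (upgrade jP (conj_C phi))),
      (upgrade jL (conj_C phi) : {set Z12}) = phi @: [set 0; 3; 4; 7; 8; 11] /\
        simply_transitive <<[set opP; opL]>>%G
          (maximal_cover (upgrade jL (conj_C phi)))
    & (upgrade jR (conj_C phi) : {set Z12}) = phi @: [set 0; 1; 3; 4; 6; 7; 9; 10] /\
        simply_transitive <<[set opP; opR]>>%G
          (maximal_cover (upgrade jR (conj_C phi)))].

Proof.
have [theta thetaE] := TI_triad_perm phi phiTI.
have coverE j : maximal_cover (upgrade j (conj_C phi)) =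
    theta @: maximal_cover (upgrade j natural_C).
  by rewrite upgrade_conj; apply: maximal_cover_imset.
have stE (H : {group {perm triad}}) j : H \subset PLR ->
    simply_transitive H (maximal_cover (upgrade j (conj_C phi))) <->
    simply_transitive H (maximal_cover (upgrade j natural_C)).
  move=> HPLR; rewrite coverE; apply: simply_transitive_imset.
  exact: subset_trans HPLR (TI_PLR_commute phi theta phiTI thetaE).
have subP : <<[set opP]>>%G \subset PLR.
  by apply/genS/subsetP => h /set1P ->; rewrite !inE eqxx.
have subL : <<[set opP; opL]>>%G \subset PLR by apply/genS/subsetUl.
have subR : <<[set opP; opR]>>%G \subset PLR by apply/genS/setSU/subsetUl.
have stP : simply_transitive <<[set opP]>>%G
    (maximal_cover (upgrade jP (conj_C phi))).
  by apply/stE => //; rewrite upgrade_jP cover_jP; apply: simply_transitive_orbit.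
have stL : simply_transitive <<[set opP; opL]>>%G
    (maximal_cover (upgrade jL (conj_C phi))).
  by apply/stE => //; rewrite upgrade_jL cover_jL; apply: simply_transitive_orbit.
have stR : simply_transitive <<[set opP; opR]>>%G
    (maximal_cover (upgrade jR (conj_C phi))).
  by apply/stE => //; rewrite upgrade_jR cover_jR; apply: simply_transitive_orbit.
split=> [j jE |]; split.
(* Each subgroup is left open and fixed by unification with [stP], [stL] or [stR]; its inclusion in
   [PLR] is then [subP], [subL] or [subR]. *)
- by case: jE => [->|[->|->]]; eexists; split; [| exact: stP | | exact: stL | | exact: stR].
- exact: upgrade_conj.
- rewrite coverE /image_collection -imset_comp.
  by apply: eq_imset => Y /=; apply: thetaE.
- by move=> H; apply: stE.
- split=> //; rewrite upgrade_conj upgrade_jP.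
  suff -> : [set z in [:: 0; 3; 4; 7]] = [set 0; 3; 4; 7] :> {set Z12} by [].
  by apply/setP => z; rewrite !inE -!orbA.
- split=> //; rewrite upgrade_conj upgrade_jL.
  suff -> : [set z in [:: 0; 3; 4; 7; 8; 11]] = [set 0; 3; 4; 7; 8; 11] :> {set Z12} by [].
  by apply/setP => z; rewrite !inE -!orbA.
- split=> //; rewrite upgrade_conj upgrade_jR.
  suff -> : [set z in [:: 0; 1; 3; 4; 6; 7; 9; 10]] = [set 0; 1; 3; 4; 6; 7; 9; 10] :> {set Z12} by [].
  by apply/setP => z; rewrite !inE -!orbA.
Qed.
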